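(* Let $\mathcal H$ be a complex separable Hilbert space, let $T \in \mathcal B(\mathcal H)$, $T\neq 0$, with polar decomposition $T = V|T|$, and let $X_0 \in \mathcal I$ satisfy $j(V^*V, X_0^*X_0) \le 0$. Then $$\|T - X_0\| = \min\{\|T - X\| : X \in \mathcal I,\ j(V^*V, X^*X) \le 0\}$$ if and only if at least one of the following holds: (i) there exist unit vectors $(\xi_n)$ in $\mathcal H$ such that $\|X_0\xi_n\| \to 1$ and $\|T - X_0\|\, X_0\xi_n - (T - X_0)\xi_n \to 0$; (ii) there exist unit vectors $(\xi_n)$ in $\mathcal H$ such that $\|X_0\xi_n\| \to 1$, $\|T - X_0\|\, X_0\xi_n + (T - X_0)\xi_n \to 0$, and $(\gamma(T)X_0 - T)\xi_n \to 0$.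
   Context: $\mathcal B(\mathcal H)$ is the algebra of bounded linear operators on $\mathcal H$, and $\|\cdot\|$ is the operator norm. $\mathcal I$ denotes the set of all partial isometries on $\mathcal H$, i.e. $X \in \mathcal B(\mathcal H)$ with $XX^*X = X$; for such $X$, $X^*X$ is the orthogonal projection onto $\ker(X)^\perp$. $|T| = (T^*T)^{1/2}$. The polar factor of $T$ is the unique $V \in \mathcal I$ with $T = V|T|$ and $\ker V = \ker T$. For orthogonal projections $P, Q$ on $\mathcal H$, define $j(P,Q) := \dim(\operatorname{ran}(P) \cap \ker(Q)) - \dim(\ker(P) \cap \operatorname{ran}(Q)) \in [-\infty, \infty]$ if at least one of these dimensions is finite, and $j(P,Q) := 0$ if both are infinite. For $T \neq 0$, the reduced minimum modulus is $\gamma(T) = \inf\{\|T\xi\| : \xi \in \ker(T)^\perp,\ \|\xi\| = 1\} = \inf\big(\sigma(|T|)\setminus\{0\}\big)$. *)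

(* Defs.v *)
From Stdlib Require Import ClassicalEpsilon.
From mathcomp Require Import all_boot all_order all_algebra.
From mathcomp Require Import all_classical all_reals all_analysis.
From mathcomp Require Import complex.
Set Implicit Arguments. Unset Strict Implicit. Unset Printing Implicit Defensive.
Import Order.TTheory GRing.Theory Num.Theory numFieldNormedType.Exports.
Local Open Scope ring_scope.
Local Open Scope classical_set_scope.

Section Hilbert.
Variable R : realType.
Local Notation C := R[i].
Variables (H : lmodType C) (ip : H -> H -> C).

Definition is_inner_product : Prop :=
  [/\ (forall x y z, ip (x + y) z = ip x z + ip y z),
      (forall (a : C) x y, ip (a *: x) y = a * ip x y),
      (forall x y, ip y x = conjc (ip x y)),
      (forall x, 0 <= ip x x) &
      (forall x, ip x x = 0 -> x = 0)].

Definition hnorm (x : H) : R := Num.sqrt (complex.Re (ip x x)).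

Definition hcomplete : Prop :=
  forall u : nat -> H,
    (forall e : R, 0 < e -> exists N : nat, forall m n : nat,
        (N <= m)%N -> (N <= n)%N -> hnorm (u m - u n) < e) ->
    exists l : H, (fun n => hnorm (u n - l)) @ \oo --> (0 : R).

Definition hseparable : Prop :=
  exists s : nat -> H, forall x (e : R), 0 < e -> exists n, hnorm (x - s n) < e.

Definition is_hilbert : Prop := [/\ is_inner_product, hcomplete & hseparable].

Definition is_linear_op (f : H -> H) : Prop :=
  forall (a : C) x y, f (a *: x + y) = a *: f x + f y.

Definition bounded_op (f : H -> H) : Prop :=
  is_linear_op f /\ exists M : R, forall x, hnorm (f x) <= M * hnorm x.

Definition opnorm (f : H -> H) : R :=
  sup [set hnorm (f x) | x in [set x | hnorm x <= 1]].

Definition is_adjoint (f g : H -> H) : Prop := forall x y, ip (f x) y = ip x (g y).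
Definition adj (f : H -> H) : H -> H := epsilon (inhabits id) (is_adjoint f).

Definition partial_isometry (X : H -> H) : Prop :=
  bounded_op X /\ forall x, X (adj X (X x)) = X x.

Definition positive_op (A : H -> H) : Prop := bounded_op A /\ forall x, 0 <= ip (A x) x.
Definition absop (T : H -> H) : H -> H :=
  epsilon (inhabits id) (fun A => positive_op A /\ forall x, A (A x) = adj T (T x)).

Definition ker (f : H -> H) : set H := [set x | f x = 0].

Definition polar_factor (T Vp : H -> H) : Prop :=
  [/\ partial_isometry Vp, (forall x, T x = Vp (absop T x)) & ker Vp = ker T].

Definition orth_compl (S : set H) : set H := [set x | forall y, S y -> ip y x = 0].

Definition gamma (T : H -> H) : R :=
  inf [set hnorm (T x) | x in orth_compl (ker T) `&` [set x | hnorm x = 1]].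

Definition hdim (S : set H) : \bar R :=
  ereal_sup [set (n%:R)%:E | n in [set n : nat | exists u : 'I_n -> H,
     (forall i, S (u i)) /\ (forall i j, ip (u i) (u j) = (i == j)%:R)]].

Definition jind (P Q : H -> H) : \bar R :=
  let a := hdim (range P `&` ker Q) in
  let b := hdim (ker P `&` range Q) in
  if (a \is a fin_num) || (b \is a fin_num) then (a - b)%E else 0%E.

End Hilbert.

(* Main.v *)
(* Let d := max(||T|| - 1, 1 - gamma(T)).  The minimum is d, attained at the polar
   factor V: on ker(T)^perp the operator |T| lies between gamma(T) and ||T||, so
   ||T - V|| <= d.  Conversely ||T - X|| >= ||T|| - 1 always, and the index
   condition gives ||T - X|| >= 1 - gamma(T): either ker(T) meets ran(X^*X), or
   ran(V^*V) meets ker(X^*X) trivially and V^*V ran(X^*X) is dense in ran(V^*V),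
   so that ran(X^*X) contains unit vectors y with ||T y|| close to gamma(T).
   Hence X0 is optimal iff ||T - X0|| is <= ||T|| - 1 or <= 1 - gamma(T).  In either
   case nearly extremal unit vectors make a triangle inequality nearly an equality, and
   the identity |ta - sb|^2 = (s + t)(t|a|^2 + s|b|^2) - st|a + b|^2 turns this into
   (i) resp. (ii). *)
Require Import Defs.
From Stdlib Require Import ClassicalEpsilon.
From mathcomp Require Import all_boot all_order all_algebra.
From mathcomp Require Import all_classical all_reals all_analysis.
From mathcomp Require Import complex ring lra.
Import Order.TTheory GRing.Theory Num.Theory numFieldNormedType.Exports.
Local Open Scope ring_scope.
Local Open Scope classical_set_scope.

Set Implicit Arguments. Unset Strict Implicit.

Local Notation "a *:: x" := (a%:C%C *: x) (at level 40).

(** * The underlying real inner product and its norm *)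

Section InnerProduct.
Context {R : realType} {H : lmodType R[i]} {ip : H -> H -> R[i]}.
Hypothesis hip : is_inner_product ip.

Local Notation nrm := (hnorm ip).

(** The real part already determines the norm and is real bilinear and symmetric, so norm estimates
    become polynomial inequalities over [R]. *)
Definition rip (x y : H) : R := complex.Re (ip x y).

Lemma ripC x y : rip x y = rip y x.
Proof. by case: hip => _ _ h _ _; rewrite /rip (h x y); case: (ip x y). Qed.

Lemma ripDl x y z : rip (x + y) z = rip x z + rip y z.
Proof. by case: hip => h _ _ _ _; rewrite /rip h raddfD. Qed.

Lemma ripDr x y z : rip z (x + y) = rip z x + rip z y.
Proof. by rewrite ripC ripDl !(ripC z). Qed.

Lemma ripZl a x y : rip (a *:: x) y = a * rip x y.
Proof.
by case: hip => _ h _ _ _; rewrite /rip h; case: (ip x y) => u v /=; rewrite mul0r subr0.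
Qed.

Lemma ripZr a x y : rip x (a *:: y) = a * rip x y.
Proof. by rewrite ripC ripZl ripC. Qed.

Lemma ripNl x y : rip (- x) y = - rip x y.
Proof.
have -> : - x = (-1) *:: x by rewrite rmorphN1 scaleN1r.
by rewrite ripZl mulN1r.
Qed.

Lemma ripNr x y : rip x (- y) = - rip x y.
Proof. by rewrite ripC ripNl ripC. Qed.

Lemma rip0l x : rip 0 x = 0.
Proof. by rewrite -(subrr x) ripDl ripNl subrr. Qed.

Lemma rip0r x : rip x 0 = 0.
Proof. by rewrite ripC rip0l. Qed.

Definition ripE := (ripDl, ripDr, ripNl, ripNr, ripZl, ripZr, rip0l, rip0r).

Lemma rip_ge0 x : 0 <= rip x x.
Proof. by case: hip => _ _ _ h _; have := h x; rewrite lecE => /andP[]. Qed.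

Lemma ip_self x : ip x x = (rip x x)%:C%C.
Proof.
case: hip => _ _ _ h _; rewrite /rip.
by rewrite RRe_real //; apply: ger0_real; exact: h.
Qed.

Lemma rip_eq0 x : rip x x = 0 -> x = 0.
Proof.
by move=> h; case: hip => _ _ _ _; apply; rewrite ip_self h.
Qed.

(** The real part of ['i * z] is minus the imaginary part of [z], so a complex identity splits into
    two real ones, the second tested at ['i *: x]. *)
Lemma ip_eq0 x y : (ip x y = 0) <-> (rip x y = 0 /\ rip ('i%C *: x) y = 0).
Proof.
case: hip => _ hZ _ _ _; rewrite /rip hZ.
case: (ip x y) => a b /=; rewrite mul0r mul1r sub0r; split.
  by case=> -> ->; rewrite oppr0.
by case=> -> /eqP; rewrite oppr_eq0 => /eqP ->.
Qed.

Lemma ip_eqP x y u v : rip x y = rip u v ->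
  rip ('i%C *: x) y = rip ('i%C *: u) v -> ip x y = ip u v.
Proof.
case: hip => _ hZ _ _ _; rewrite /rip !hZ.
case: (ip x y) (ip u v) => a b [c d] /= ->; rewrite !mul0r !mul1r !sub0r.
by move/oppr_inj ->.
Qed.

Lemma rip_i x y : rip ('i%C *: x) ('i%C *: y) = rip x y.
Proof.
case: hip => _ hZ hc _ _; rewrite /rip hZ hc hZ hc.
by case: (ip x y) => a b /=; ring.
Qed.

Lemma hnorm_ge0 x : 0 <= nrm x. Proof. exact: sqrtr_ge0. Qed.

Lemma hnorm_sqr x : nrm x ^+ 2 = rip x x.
Proof. by rewrite /hnorm sqr_sqrtr // rip_ge0. Qed.

Lemma hnorm0 : nrm 0 = 0.
Proof. by apply/eqP; rewrite -sqrf_eq0 hnorm_sqr rip0l. Qed.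

Lemma hnorm_eq0 x : nrm x = 0 -> x = 0.
Proof. by move=> h; apply: rip_eq0; rewrite -hnorm_sqr h expr0n. Qed.

Lemma hnorm_gt0 x : x <> 0 -> 0 < nrm x.
Proof.
by move=> h; rewrite lt_def hnorm_ge0 andbT; apply/eqP => /hnorm_eq0.
Qed.

Lemma hnormZ a x : nrm (a *:: x) = `|a| * nrm x.
Proof.
apply/eqP; rewrite -(@eqrXn2 _ 2) ?mulr_ge0 ?hnorm_ge0 //.
by rewrite exprMn !hnorm_sqr !ripE real_normK ?num_real //; apply/eqP; ring.
Qed.

Lemma hnormN x : nrm (- x) = nrm x.
Proof.
by apply/eqP; rewrite -(@eqrXn2 _ 2) ?hnorm_ge0 // !hnorm_sqr !ripE opprK.
Qed.

Lemma hdistC x y : nrm (x - y) = nrm (y - x).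
Proof. by rewrite -hnormN opprB. Qed.

Lemma hnorm_leP x c : 0 <= c -> (nrm x <= c) <-> (rip x x <= c ^+ 2).
Proof. by move=> c0; rewrite -hnorm_sqr ler_pXn2r // nnegrE // hnorm_ge0. Qed.

Lemma rip_cauchy_sqr x y : rip x y ^+ 2 <= rip x x * rip y y.
Proof.
have [y0|y0] := eqVneq (rip y y) 0.
  by move/rip_eq0: y0 ->; rewrite !ripE expr0n mulr0.
have yp : 0 < rip y y by rewrite lt_def y0 rip_ge0.
(* The component of [x] orthogonal to [y], multiplied by [rip y y] to avoid a division. *)
have := rip_ge0 (rip y y *:: x - rip x y *:: y).
rewrite !ripE (ripC y x) => h.
have {h} : 0 <= rip y y * (rip x x * rip y y - rip x y ^+ 2).
  by move: h; lra.
by rewrite pmulr_rge0 // subr_ge0.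
Qed.

Lemma rip_le_norm x y : rip x y <= nrm x * nrm y.
Proof.
have h0 : 0 <= nrm x * nrm y by rewrite mulr_ge0 ?hnorm_ge0.
apply: le_trans (ler_norm _) _.
rewrite -(@ler_pXn2r _ 2) ?nnegrE //.
by rewrite real_normK ?num_real // exprMn !hnorm_sqr rip_cauchy_sqr.
Qed.

Lemma rip_norm_le x y : `|rip x y| <= nrm x * nrm y.
Proof.
by rewrite ler_norml lerNl -ripNl -{1}(hnormN x) !rip_le_norm.
Qed.

Lemma hnormD x y : nrm (x + y) <= nrm x + nrm y.
Proof.
apply/hnorm_leP; first by rewrite addr_ge0 ?hnorm_ge0.
rewrite !ripE (ripC y x) -!hnorm_sqr.
have := rip_le_norm x y; nra.
Qed.

Lemma hnormB x y : nrm (x - y) <= nrm x + nrm y.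
Proof. by rewrite -(hnormN y) hnormD. Qed.

Lemma hnorm_triangle y x z : nrm (x - z) <= nrm (x - y) + nrm (y - z).
Proof. by apply: le_trans (hnormD _ _); rewrite addrA subrK. Qed.

Lemma hnorm_le_add x y : nrm x <= nrm y + nrm (x - y).
Proof. by apply: le_trans (hnormD _ _); rewrite addrC subrK. Qed.

(** Measures near equality in the triangle inequality: if [nrm a <= s] and [nrm b <= t], with
    [nrm (a + b)] close to [s + t], the right-hand side is close to 0. *)
Lemma hnorm_comb_sqr (s t : R) a b :
  nrm (t *:: a - s *:: b) ^+ 2
  = (s + t) * (t * nrm a ^+ 2 + s * nrm b ^+ 2) - s * t * nrm (a + b) ^+ 2.
Proof. by rewrite !hnorm_sqr !ripE (ripC b a); ring. Qed.

Lemma hnormalize x : x <> 0 -> nrm ((nrm x)^-1 *:: x) = 1.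
Proof.
move=> /hnorm_gt0 h; rewrite hnormZ ger0_norm ?invr_ge0 ?hnorm_ge0 //.
by rewrite mulVf // gt_eqF.
Qed.

Lemma rip_ext x y : (forall z, rip z x = rip z y) -> x = y.
Proof.
move=> h; apply/eqP; rewrite -subr_eq0; apply/eqP/rip_eq0.
by rewrite ripDr ripNr h subrr.
Qed.

End InnerProduct.

(** * Bounded operators and the operator norm *)

Section Operators.
Context {R : realType} {H : lmodType R[i]} {ip : H -> H -> R[i]}.
Hypothesis hip : is_inner_product ip.
Local Notation nrm := (hnorm ip).
Local Notation linop := (@is_linear_op R H).
Local Notation rip := (@rip R H ip).

Section Linear.
Context {f : H -> H}.
Hypothesis lf : linop f.

Lemma linopD x y : f (x + y) = f x + f y.
Proof. by have := lf 1 x y; rewrite !scale1r. Qed.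

Lemma linop0 : f 0 = 0.
Proof. by apply: (addrI (f 0)); rewrite -linopD !addr0. Qed.

Lemma linopZ a x : f (a *: x) = a *: f x.
Proof. by have := lf a x 0; rewrite !addr0 linop0 addr0. Qed.

Lemma linopN x : f (- x) = - f x.
Proof. by rewrite -scaleN1r linopZ scaleN1r. Qed.

Lemma linopB x y : f (x - y) = f x - f y.
Proof. by rewrite linopD linopN. Qed.
End Linear.

Lemma linop_comp f g : linop f -> linop g -> linop (f \o g).
Proof. by move=> hf hg a x y; rewrite /= hg hf. Qed.

Lemma linop_sub f g : linop f -> linop g ->
  linop (fun x => f x - g x).
Proof. by move=> hf hg a x y; rewrite hf hg scalerBr opprD !addrA; congr (_ - _); rewrite addrAC. Qed.

Lemma bounded_pos f : bounded_op ip f ->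
  exists2 M, 0 < M & forall x, nrm (f x) <= M * nrm x.
Proof.
move=> [_ [M hM]]; exists (`|M| + 1); first by rewrite ltr_wpDl.
move=> x; apply: le_trans (hM x) _; apply: ler_wpM2r; first exact: hnorm_ge0.
by apply: le_trans (ler_norm _) _; rewrite lerDl.
Qed.

Lemma bounded_sub f g : bounded_op ip f -> bounded_op ip g ->
  bounded_op ip (fun x => f x - g x).
Proof.
move=> hf hg; split; first by apply: linop_sub; [case: hf|case: hg].
have [M _ hM] := bounded_pos hf; have [N _ hN] := bounded_pos hg.
exists (M + N) => x; apply: le_trans (hnormB hip _ _) _.
by rewrite mulrDl lerD.
Qed.

Lemma opnorm_has_sup f : bounded_op ip f ->
  has_sup [set nrm (f x) | x in [set x | nrm x <= 1]].
Proof.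
move=> bf; split.
  by exists (nrm (f 0)), 0 => //=; rewrite hnorm0.
have [M M0 hM] := bounded_pos bf; exists M => _ [x /= hx <-].
by apply: le_trans (hM x) _; rewrite -[leRHS]mulr1 ler_pM2l.
Qed.

Lemma opnorm_ge0 f : bounded_op ip f -> 0 <= opnorm ip f.
Proof.
move=> bf; apply: (le_trans (hnorm_ge0 (f 0))).
by apply: ub_le_sup; [case: (opnorm_has_sup bf)|exists 0 => //=; rewrite hnorm0].
Qed.

Lemma le_opnorm f : bounded_op ip f -> forall x, nrm (f x) <= opnorm ip f * nrm x.
Proof.
move=> bf x; have [->|/eqP x0] := eqVneq x 0.
  by rewrite (linop0 (proj1 bf)) hnorm0 // mulr0.
have xp := hnorm_gt0 hip x0.
rewrite -ler_pdivrMr //.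
have -> : nrm (f x) / nrm x = nrm (f ((nrm x)^-1 *:: x)).
  by rewrite (linopZ (proj1 bf)) hnormZ // ger0_norm ?invr_ge0 ?hnorm_ge0 // mulrC.
apply: ub_le_sup; first by case: (opnorm_has_sup bf).
by exists ((nrm x)^-1 *:: x) => //=; rewrite hnormalize.
Qed.

Lemma opnorm_le f c : 0 <= c -> (forall x, nrm (f x) <= c * nrm x) ->
  opnorm ip f <= c.
Proof.
move=> c0 h; apply: ge_sup.
  by exists (nrm (f 0)), 0 => //=; rewrite hnorm0.
move=> _ [x /= hx <-]; apply: le_trans (h x) _.
by rewrite -[leRHS]mulr1 ler_wpM2l.
Qed.

Lemma opnorm_approx f e : bounded_op ip f -> 0 < e -> 0 < opnorm ip f ->
  exists2 x, nrm x = 1 & opnorm ip f - e < nrm (f x).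
Proof.
move=> bf e0 op0.
apply: contrapT => hn.
have hle x : nrm x = 1 -> nrm (f x) <= opnorm ip f - e.
  by move=> hx; rewrite leNgt; apply/negP => hl; apply: hn; exists x.
(* The maximum with 0 supplies the nonnegative constant that [opnorm_le] asks for; the value 0 is
   then excluded by [op0]. *)
pose c := Num.max (opnorm ip f - e) 0.
suff : opnorm ip f <= c.
  by rewrite /c le_max => /orP[]; [rewrite lerBrDr gerDl leNgt e0|rewrite leNgt op0].
apply: opnorm_le; first by rewrite /c le_max lexx orbT.
move=> x; have [->|/eqP x0] := eqVneq x 0.
  by rewrite (linop0 (proj1 bf)) hnorm0 // mulr0.
rewrite -ler_pdivrMr ?hnorm_gt0 //.
have -> : nrm (f x) / nrm x = nrm (f ((nrm x)^-1 *:: x)).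
  by rewrite (linopZ (proj1 bf)) hnormZ // ger0_norm ?invr_ge0 ?hnorm_ge0 // mulrC.
by rewrite /c le_max hle // hnormalize.
Qed.

End Operators.

(** * Epsilon arguments over the reals *)

Section RealLemmas.
Context {R : realType}.

Lemma seq_cvg0P (u : nat -> R) : (forall n, 0 <= u n) ->
  u @ \oo --> (0 : R) <->
  forall e : R, 0 < e -> exists N, forall n, (N <= n)%N -> u n < e.
Proof.
move=> u0; split.
  move=> /cvgrPdist_lt h e e0; have [N _ hN] := h _ e0; exists N => n Nn.
  by have := hN n Nn; rewrite /= sub0r normrN ger0_norm.
move=> h; apply/cvgrPdist_lt => e e0; have [N hN] := h _ e0; exists N => // n Nn /=.
by rewrite sub0r normrN ger0_norm // hN.
Qed.

Lemma natSinv_lt (e : R) : 0 < e ->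
  exists N, forall n, (N <= n)%N -> n.+1%:R^-1 < e.
Proof. by move=> e0; have [N _ hN] := near_infty_natSinv_lt (PosNum e0); exists N. Qed.

(** Stands in for passing to the limit: an inequality is proved with an arbitrarily small slack,
    which is then dropped. *)
Lemma le0_eps (b c : R) : 0 <= c -> (forall d, 0 < d -> b <= c * d) -> b <= 0.
Proof.
move=> c0 h; rewrite leNgt; apply/negP => b0.
have d0 : 0 < b / (2 * (c + 1)) by apply: divr_gt0 => //; lra.
have := h _ d0; apply/negP; rewrite -ltNge.
rewrite mulrCA -[ltRHS]mulr1 ltr_pM2l // ltr_pdivrMr; lra.
Qed.
End RealLemmas.

(** * Riesz representation, projections and adjoints *)

Section Riesz.
Context {R : realType} {H : lmodType R[i]} {ip : H -> H -> R[i]}.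
Hypothesis hip : is_inner_product ip.
Hypothesis hcpl : hcomplete ip.
Local Notation nrm := (hnorm ip).
Local Notation linop := (@is_linear_op R H).
Local Notation rip := (@rip R H ip).

(* The minimiser of [|x|^2 - 2 phi x] over the closure of [S]; taking for [S]
   the whole space gives the Riesz theorem, and for [phi] an inner product the
   orthogonal projection. *)
Lemma riesz_subspace (S : set H) (phi : H -> R) (M : R) :
  S 0 -> (forall x y, S x -> S y -> S (x + y)) ->
  (forall a x, S x -> S (a *:: x)) ->
  (forall x y, phi (x + y) = phi x + phi y) ->
  (forall a x, phi (a *:: x) = a * phi x) ->
  (forall x, phi x <= M * nrm x) ->
  exists l, (forall e : R, 0 < e -> exists2 s, S s & nrm (s - l) < e) /\
            (forall s, S s -> rip s l = phi s).
Proof.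
move=> S0 SD SZ pD pZ pM.
pose J x : R := rip x x - 2 * phi x.
have Jlb x : - M ^+ 2 <= J x.
  have := pM x; rewrite /J -hnorm_sqr // => h.
  have := sqr_ge0 (nrm x - M); nra.
pose A := [set J x | x in S].
have iA : has_inf A.
  by split; [exists (J 0), 0|exists (- M ^+ 2) => _ [x _ <-]].
pose m : R := inf A.
have mJ x : S x -> m <= J x.
  by move=> Sx; apply: ge_inf; [case: iA|exists x].
have Jm (e : R) : 0 < e -> exists2 x, S x & J x < m + e.
  by move=> e0; have [_ [x Sx <-] hx] := inf_adherent e0 iA; exists x.
(* The parallelogram law, with [J] at the midpoint bounded below by [m]; it makes minimising
   sequences Cauchy. *)
have par x y : S x -> S y -> rip (x - y) (x - y) <= 2 * (J x - m) + 2 * (J y - m).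
  move=> Sx Sy; have := mJ (2^-1 *:: (x + y)) (SZ _ _ (SD _ _ Sx Sy)).
  rewrite /J pZ pD !(ripE hip) (ripC hip y x); lra.
have /choice[u hu] n : exists x, S x /\ J x < m + n.+1%:R^-1.
  have [|x Sx hx] := Jm n.+1%:R^-1; first by rewrite invr_gt0.
  by exists x.
have [|l /seq_cvg0P hl] := hcpl (u := u).
  move=> e e0; have [|N hN] := @natSinv_lt R (e ^+ 2 / 4).
    by rewrite divr_gt0 // exprn_gt0.
  exists N => p q Np Nq; rewrite -(@ltr_pXn2r _ 2) ?nnegrE ?hnorm_ge0 ?(ltW e0) //.
  rewrite hnorm_sqr //; have [Sp Jp] := hu p; have [Sq Jq] := hu q.
  apply: le_lt_trans (par _ _ Sp Sq) _.
  have aux (a b x y f : R) : x < m + a -> y < m + b -> a < f / 4 -> b < f / 4 ->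
    2 * (x - m) + 2 * (y - m) < f by clear; lra.
  exact: (aux _ _ _ _ _ Jp Jq (hN _ Np) (hN _ Nq)).
(* [S] need not be closed, so [l] is handled through nearby points of [S]. The excess [d ^+ 2]
   matches the quadratic estimate below, whose square root is linear in [d]. *)
have {hl} appr (d : R) : 0 < d -> exists x, [/\ S x, J x < m + d ^+ 2 & nrm (x - l) < d].
  move=> d0; have [N hN] := hl (fun=> hnorm_ge0 _) _ d0.
  have [|N' hN'] := @natSinv_lt R (d ^+ 2); first by rewrite exprn_gt0.
  exists (u (maxn N N')); have [Su Ju] := hu (maxn N N'); split => //.
    by apply: lt_trans Ju _; rewrite ltrD2l hN' // leq_maxr.
  by apply: hN; rewrite leq_maxl.
exists l; split.
  by move=> e e0; have [x [Sx _ hx]] := appr _ e0; exists x.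
move=> s Ss; have [s0|/eqP s0] := eqVneq s 0.
  rewrite s0 rip0l //; have := pZ 0 s; rewrite s0 scaler0 mul0r => ->.
  by [].
have sp := hnorm_gt0 hip s0.
apply/eqP; rewrite -subr_eq0 -normr_le0.
apply: (@le0_eps _ _ (2 * nrm s)); first by rewrite mulr_ge0 // ltW.
move=> d d0; have [x [Sx Jx xl]] := appr d d0.
have hx : `|rip s x - phi s| <= nrm s * d.
  rewrite -(@ler_pXn2r _ 2) ?nnegrE ?mulr_ge0 ?hnorm_ge0 ?(ltW d0) //.
  rewrite real_normK ?num_real // exprMn hnorm_sqr //.
  set ss := rip s s; have ssp : 0 < ss by rewrite /ss -hnorm_sqr // exprn_gt0.
  set c := _ - _.
  (* The step [- c / ss] minimises [J] along the line through [x] in direction [s]; the decrease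
     [c ^+ 2 / ss] cannot exceed the excess [d ^+ 2]. *)
  have := mJ (x + (- c / ss) *:: s) (SD _ _ Sx (SZ _ _ Ss)).
  have -> : J (x + (- c / ss) *:: s) = J x - c ^+ 2 / ss.
    rewrite /J pD pZ !(ripE hip) (ripC hip x s) -/ss /c; field.
    by rewrite gt_eqF.
  move=> h; have {h} : c ^+ 2 / ss <= d ^+ 2 by lra.
  by rewrite ler_pdivrMr // mulrC.
have -> : rip s l - phi s = (rip s x - phi s) + rip s (l - x).
  by rewrite ripDr // ripNr //; ring.
apply: le_trans (ler_normD _ _) _.
have : `|rip s (l - x)| <= nrm s * d.
  apply: le_trans (rip_norm_le hip _ _) _.
  by rewrite ler_pM2l // hdistC // ltW.
lra.
Qed.

Lemma adjoint_exists f : bounded_op ip f -> exists g, is_adjoint ip f g.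
Proof.
move=> bf; have lf := proj1 bf; have [M M0 hM] := bounded_pos bf.
suff /choice[g hg] y : exists z, forall x, ip (f x) y = ip x z.
  by exists g => x y; exact: hg.
have [||||x|l [_ hl]] := @riesz_subspace setT (fun x => rip (f x) y) (M * nrm y) I; rewrite //.
- by move=> x z; rewrite linopD // ripDl.
- by move=> a x; rewrite linopZ // ripZl.
- apply: le_trans (rip_le_norm hip _ _) _.
  by rewrite mulrAC ler_wpM2r ?hnorm_ge0.
(* Since [f] commutes with ['i], the real identity holds at ['i *: x] as well and upgrades to the
   complex one. *)
by exists l => x; apply: (ip_eqP hip); rewrite -?(linopZ lf) hl.
Qed.

Lemma adjP f : bounded_op ip f -> is_adjoint ip f (adj ip f).
Proof. by move=> bf; apply: epsilon_spec; exact: adjoint_exists. Qed.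

Lemma rip_adj f x y : bounded_op ip f -> rip (f x) y = rip x (adj ip f y).
Proof. by move=> bf; rewrite /rip (adjP bf). Qed.

Lemma adj_linear f : bounded_op ip f -> linop (adj ip f).
Proof.
move=> bf a x y; apply: (rip_ext hip) => z.
rewrite -rip_adj // !ripDr // -!rip_adj //; congr (_ + _).
rewrite /rip.
case: (hip) => _ hZ hc _ _.
have sc u v : ip u (a *: v) = conjc a * ip u v by rewrite hc hZ rmorphM (hc v u).
by rewrite !sc (adjP bf).
Qed.

End Riesz.

(** * Positive operators and their square roots *)

Section PositiveOperators.
Context {R : realType} {H : lmodType R[i]} {ip : H -> H -> R[i]}.
Hypothesis hip : is_inner_product ip.
Hypothesis hcpl : hcomplete ip.
Local Notation nrm := (hnorm ip).
Local Notation linop := (@is_linear_op R H).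
Local Notation rip := (@rip R H ip).

Definition rsymmetric (f : H -> H) := forall x y, rip (f x) y = rip x (f y).

Lemma rip_iN x y : rip ('i%C *: x) y = - rip x ('i%C *: y).
Proof.
by rewrite -(rip_i hip ('i%C *: x)) scalerA -expr2 sqr_i scaleN1r ripNl.
Qed.

Lemma rsymmetric_Im f x : linop f -> rsymmetric f -> complex.Im (ip (f x) x) = 0.
Proof.
move=> lf sf; have : rip ('i%C *: f x) x = 0.
  have := rip_iN x (f x); rewrite -sf (linopZ lf) (ripC hip x); lra.
case: (hip) => _ hZ _ _ _; rewrite /rip hZ.
by case: (ip (f x) x) => a b /=; rewrite mul0r mul1r sub0r => /eqP; rewrite oppr_eq0 => /eqP.
Qed.

(** A complex form that is real on the diagonal is hermitian: its vanishing imaginary part is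
    expanded at [x + y], and then [x] is replaced by [- 'i%C *: x]. *)
Lemma positive_op_sym A : positive_op ip A -> rsymmetric A.
Proof.
move=> [[lA _] pA].
have i0 x : rip ('i%C *: A x) x = 0.
  have := pA x; rewrite lecE => /andP[/eqP h _].
  case: (hip) => _ hZ _ _ _; rewrite /rip hZ.
  by move: h; case: (ip (A x) x) => a b /= ->; rewrite mul0r mul1r subrr.
have key x y : rip ('i%C *: A x) y = rip ('i%C *: x) (A y).
  have := i0 (x + y); rewrite (linopD lA) scalerDr !(ripE hip) !i0.
  by rewrite (rip_iN (A y) x) (ripC hip (A y)); lra.
move=> x y; have := key (- 'i%C *: x) y.
rewrite (linopZ lA) !scalerA mulrN -expr2 sqr_i opprK !scale1r.
by [].
Qed.

(* Evaluate the form of [B] at [c x - B x]. *)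
Lemma posform_bound (K : set H) (B : H -> H) (c : R) :
  linop B -> rsymmetric B -> 0 < c ->
  (forall a x y, K x -> K y -> K (a *:: x - y)) ->
  (forall x, K x -> K (B x)) ->
  (forall x, K x -> 0 <= rip (B x) x <= c * rip x x) ->
  forall x, K x -> rip (B x) (B x) <= c * rip (B x) x.
Proof.
move=> lB sB c0 KB KBx hB x Kx.
have /andP[h1 _] := hB _ (KB c _ _ Kx (KBx _ Kx)).
have /andP[_ h2] := hB _ (KBx _ Kx).
move: h1; rewrite (linopB lB) (linopZ lB) !(ripE hip) (sB (B x) x) => h1.
have : 0 <= c * (c * rip (B x) x - rip (B x) (B x)) by lra.
by rewrite pmulr_rge0 // subr_ge0.
Qed.

Definition hcvg (u : nat -> H) l :=
  forall e : R, 0 < e -> exists N, forall n, (N <= n)%N -> nrm (u n - l) < e.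

Lemma hcvg_unique u l l' : hcvg u l -> hcvg u l' -> l = l'.
Proof.
move=> h h'; apply/eqP; rewrite -subr_eq0; apply/eqP/(hnorm_eq0 hip)/eqP.
rewrite eq_le hnorm_ge0 andbT; apply: (@le0_eps _ _ 2) => // d d0.
have [N hN] := h _ d0; have [N' hN'] := h' _ d0.
have := hN _ (leq_maxl N N'); have := hN' _ (leq_maxr N N').
have := hnorm_triangle hip (u (maxn N N')) l l'.
rewrite (hdistC hip l (u _)); lra.
Qed.

Lemma hcvg_le (c : R) u l v l' : 0 < c -> hcvg u l ->
  (forall n, nrm (v n - l') <= c * nrm (u n - l)) -> hcvg v l'.
Proof.
move=> c0 h hv e e0; have [|N hN] := h (e / c); first by rewrite divr_gt0.
exists N => n Nn; apply: le_lt_trans (hv n) _.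
by rewrite mulrC -ltr_pdivlMr // hN.
Qed.

Lemma hcvgD u l v l' : hcvg u l -> hcvg v l' -> hcvg (fun n => u n + v n) (l + l').
Proof.
move=> h h' e e0; have e2 : 0 < e / 2 by rewrite divr_gt0.
have [N hN] := h _ e2; have [N' hN'] := h' _ e2.
exists (maxn N N') => n; rewrite geq_max => /andP[/hN {}hN /hN' {}hN'].
rewrite opprD addrACA; have := hnormD hip (u n - l) (v n - l'); lra.
Qed.

Lemma hnormZ_bound (a : R[i]) :
  exists2 c : R, 0 < c & forall x, nrm (a *: x) <= c * nrm x.
Proof.
exists (`|complex.Re a| + `|complex.Im a| + 1) => [|x].
  by rewrite ltr_wpDl // addr_ge0.
rewrite {1}(complexE a) scalerDl mulrC -scalerA.
apply: le_trans (hnormD hip _ _) _; rewrite !hnormZ //.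
have -> : nrm ('i%C *: x) = nrm x by rewrite /hnorm; congr Num.sqrt; exact: rip_i.
have := hnorm_ge0 (ip := ip) x; lra.
Qed.

Lemma hcvgZ (a : R[i]) u l : hcvg u l -> hcvg (fun n => a *: u n) (a *: l).
Proof.
move=> h; have [c c0 hc] := hnormZ_bound a.
by apply: (hcvg_le c0 h) => n; rewrite -scalerBr.
Qed.

Lemma hcvg_cst l : hcvg (fun=> l) l.
Proof. by move=> e e0; exists 0%N => n _; rewrite subrr hnorm0. Qed.

Lemma hcvg_norm_le u l (c : R) : hcvg u l -> (forall n, nrm (u n) <= c) -> nrm l <= c.
Proof.
move=> h hu; rewrite -subr_le0; apply: (@le0_eps _ _ 1) => // d d0.
have [N hN] := h _ d0; have := hN _ (leqnn N).
have := hnorm_le_add hip l (u N); rewrite hdistC //; have := hu N; lra.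
Qed.

(** * The fixed-point iteration behind the square root *)

Section SquareRootIteration.
Context {E : H -> H}.
Hypotheses (lE : linop E) (sE : rsymmetric E) (E1 : forall x, nrm (E x) <= nrm x).

Fixpoint sqrt_iter n : H -> H :=
  if n is m.+1 then fun x => 2^-1 *:: (E x + sqrt_iter m (sqrt_iter m x))
  else fun=> 0.

(** The scalar iteration for [E = 1]. It majorises the iterates and their increments, so convergence
    is read off from a bounded real sequence. *)
Fixpoint sqrt_bound n : R := if n is m.+1 then (1 + sqrt_bound m ^+ 2) / 2 else 0.

Local Notation X := sqrt_iter.
Local Notation t := sqrt_bound.

Let t01 n : 0 <= t n <= 1.
Proof. by elim: n => [|n IH] /=; [rewrite lexx ler01|nra]. Qed.

Let lX n : linop (X n).
Proof.
elim: n => [|n IH] a x y /=; first by rewrite scaler0 addr0.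
rewrite lE !IH scalerA mulrC -scalerA -scalerDr; congr (_ *: _).
by rewrite addrACA -scalerDr.
Qed.

Let sX n : rsymmetric (X n).
Proof.
elim: n => [|n IH] x y /=; first by rewrite rip0l // rip0r.
by rewrite !(ripE hip) sE !IH.
Qed.

Let XE n x : X n (E x) = E (X n x).
Proof.
elim: n x => [|n IH] x /=; first by rewrite (linop0 lE).
by rewrite (linopZ lE) (linopD lE) !IH.
Qed.

(** The iterates are polynomials in [E]; commutation lets the difference of two consecutive squares
    factor. *)
Let XXS n x : X n (X n.+1 x) = X n.+1 (X n x).
Proof. by rewrite /= (linopZ (lX n)) (linopD (lX n)) XE. Qed.

Let Xt n x : nrm (X n x) <= t n * nrm x.
Proof.
elim: n x => [|n IH] x /=; first by rewrite hnorm0 // mul0r.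
rewrite hnormZ // ger0_norm ?invr_ge0 //.
have h1 := hnormD hip (E x) (X n (X n x)).
have h2 := E1 x; have h3 := IH (X n x); have /andP[t0 _] := t01 n.
have h4 : t n * nrm (X n x) <= t n * (t n * nrm x) by rewrite ler_wpM2l.
lra.
Qed.

Let X1 n x : nrm (X n x) <= nrm x.
Proof.
apply: le_trans (Xt n x) _; have /andP[_ h] := t01 n.
by rewrite -[leRHS]mul1r ler_wpM2r // hnorm_ge0.
Qed.

(** By induction: a new increment is half of [(X n.+1 - X n)] composed with [(X n.+1 + X n)], and
    the increments of [t] factor in the same way. *)
Let dX n x : nrm (X n.+1 x - X n x) <= (t n.+1 - t n) * nrm x.
Proof.
elim: n x => [|n IH] x.
  by rewrite /= addr0 subr0 hnormZ // ger0_norm ?invr_ge0 //; have := E1 x; lra.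
have -> : X n.+2 x - X n.+1 x =
    2^-1 *:: (X n.+1 (X n.+1 x + X n x) - X n (X n.+1 x + X n x)).
  have aux (p q r s : H) : p + q - (p + r) = q + s - (s + r).
    by rewrite !opprD addrACA subrr add0r addrA addrK.
  rewrite (linopD (lX n.+1)) (linopD (lX n)) XXS.
  transitivity (2^-1 *:: (E x + X n.+1 (X n.+1 x)) - 2^-1 *:: (E x + X n (X n x))) => //.
  by rewrite -scalerBr; congr (_ *: _); exact: aux.
rewrite hnormZ // ger0_norm ?invr_ge0 //.
have h1 := IH (X n.+1 x + X n x).
have h2 := hnormD hip (X n.+1 x) (X n x).
have h3 := Xt n.+1 x; have h4 := Xt n x.
have d0 : 0 <= t n.+1 - t n by rewrite /=; have := sqr_ge0 (1 - t n); lra.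
have h5 : (t n.+1 - t n) * nrm (X n.+1 x + X n x)
          <= (t n.+1 - t n) * ((t n.+1 + t n) * nrm x).
  by rewrite ler_wpM2l //; lra.
have -> : t n.+2 = (1 + t n.+1 ^+ 2) / 2 by [].
have e1 : t n ^+ 2 = 2 * t n.+1 - 1 by rewrite /=; lra.
have -> : (1 + t n.+1 ^+ 2) / 2 - t n.+1 = 2^-1 * ((t n.+1 - t n) * (t n.+1 + t n)).
  have -> : (t n.+1 - t n) * (t n.+1 + t n) = t n.+1 ^+ 2 - t n ^+ 2 by ring.
  by rewrite e1; field.
lra.
Qed.

Let dXn n k x : nrm (X (n + k) x - X n x) <= (t (n + k)%N - t n) * nrm x.
Proof.
elim: k => [|k IH]; first by rewrite addn0 !subrr hnorm0 // mul0r.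
rewrite addnS; have := hnorm_triangle hip (X (n + k) x) (X (n + k).+1 x) (X n x).
have := dX (n + k) x; lra.
Qed.

Let X_cvg x : exists l, hcvg (X ^~ x) l.
Proof.
pose T := range t; have sT : has_sup T.
  split; first by exists (t 0), 0%N.
  by exists 1 => _ [n _ <-]; have /andP[] := t01 n.
have tle n : t n <= sup T by apply: ub_le_sup; [case: sT|exists n].
have [|l /seq_cvg0P hl] := hcpl (u := X ^~ x); last first.
  by exists l => e e0; exact: (hl (fun=> hnorm_ge0 _)).
(* Two errors of size [d * nrm x] must fit below [e]; the summand 1 covers [x = 0]. *)
move=> e e0; pose d := e / (2 * (nrm x + 1)).
have x1 : 0 < nrm x + 1 by rewrite ltr_wpDl // hnorm_ge0.
have d0 : 0 < d by rewrite divr_gt0 // mulr_gt0.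
have [_ [N _ <-] hN] := sup_adherent d0 sT.
have close n : (N <= n)%N -> nrm (X n x - X N x) <= d * nrm x.
  move=> Nn; have := dXn N (n - N) x; rewrite subnKC // => h.
  apply: le_trans h _; rewrite ler_wpM2r ?hnorm_ge0 //; have := tle n; lra.
exists N => p q Np Nq.
have h1 := close _ Np; have h2 := close _ Nq.
have h3 := hnorm_triangle hip (X N x) (X p x) (X q x).
rewrite (hdistC hip (X N x)) in h3.
have h4 : d * (2 * (nrm x + 1)) = e by rewrite /d divfK // gt_eqF // mulr_gt0.
have h5 := hnorm_ge0 (ip := ip) x.
lra.
Qed.

Lemma half_square_fixpoint : exists L,
  [/\ linop L, rsymmetric L, forall x, nrm (L x) <= nrm x &
      forall x, L x = 2^-1 *:: (E x + L (L x))].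
Proof.
have [L hL] := choice X_cvg.
have lL : linop L.
  move=> a x y; apply: hcvg_unique (hL _) _.
  have -> : X ^~ (a *: x + y) = (fun n => a *: X n x + X n y).
    by apply/funext => n; rewrite lX.
  by apply: hcvgD => //; exact: hcvgZ.
have L1 x : nrm (L x) <= nrm x by apply: hcvg_norm_le (hL x) _ => n.
have sL : rsymmetric L.
  move=> x y; apply/eqP; rewrite -subr_eq0 -normr_le0.
  apply: (@le0_eps _ _ (nrm x + nrm y)); first by rewrite addr_ge0 ?hnorm_ge0.
  move=> d d0; have [N hN] := hL x _ d0; have [N' hN'] := hL y _ d0.
  have {}hN := hN _ (leq_maxl N N'); have {}hN' := hN' _ (leq_maxr N N').
  set n := maxn N N' in hN hN'.
  have -> : rip (L x) y - rip x (L y) = rip (L x - X n x) y + rip x (X n y - L y).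
    by rewrite !(ripE hip) sX; ring.
  rewrite mulrDl [leRHS]addrC; apply: le_trans (ler_normD _ _) (lerD _ _).
    apply: le_trans (rip_norm_le hip _ _) _.
    by rewrite mulrC hdistC // ler_wpM2l ?hnorm_ge0 // ltW.
  apply: le_trans (rip_norm_le hip _ _) _.
  by rewrite ler_wpM2l ?hnorm_ge0 // ltW.
have fixL x : L x = 2^-1 *:: (E x + L (L x)).
  (* Index and argument vary together; the comparison goes through [X n (L x)], where [X n] being a
     contraction controls the first difference. *)
  have h : hcvg (fun n => X n (X n x)) (L (L x)).
    move=> e e0; have e2 : 0 < e / 2 by rewrite divr_gt0.
    have [N hN] := hL x _ e2; have [N' hN'] := hL (L x) _ e2.
    exists (maxn N N') => n; rewrite geq_max => /andP[/hN {}hN /hN' {}hN'].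
    apply: le_lt_trans (hnorm_triangle hip (X n (L x)) _ _) _.
    by rewrite -(linopB (lX n)); have := X1 n (X n x - L x); lra.
  apply: (@hcvg_unique (fun n => X n.+1 x)).
    move=> e e0; have [N hN] := hL x _ e0; exists N => n Nn.
    by apply: hN; exact: leqW.
  by apply: hcvgZ; apply: hcvgD => //; exact: hcvg_cst.
by exists L.
Qed.

End SquareRootIteration.

(* If [L = (E + L^2)/2] with [E = 1 - A] then [(1 - L)^2 = 1 - E = A]. *)
Lemma contraction_sqrt_exists (A : H -> H) :
  linop A -> rsymmetric A -> (forall x, 0 <= rip (A x) x <= rip x x) ->
  exists2 S, positive_op ip S & forall x, S (S x) = A x.
Proof.
move=> lA sA A01; pose E x := x - A x.
have lE : linop E by apply: linop_sub => // a x y.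
have sE : rsymmetric E by move=> x y; rewrite /E !(ripE hip) sA.
have E1 x : nrm (E x) <= nrm x.
  have hE y : 0 <= rip (E y) y <= 1 * rip y y.
    by rewrite /E !(ripE hip); have := A01 y; lra.
  apply/hnorm_leP; rewrite ?hnorm_ge0 // hnorm_sqr //.
  (* With [c = 1] this gives [rip (E x) (E x) <= rip (E x) x], and the latter is at most
     [rip x x]. *)
  have := @posform_bound setT E 1 lE sE ltr01 (fun _ _ _ _ _ => I) (fun _ _ => I)
    (fun y _ => hE y) x I.
  by have := hE x; lra.
have [L [lL sL L1 fixL]] := half_square_fixpoint lE sE E1.
have lS : linop (fun x => x - L x) by apply: linop_sub => // a x y.
exists (fun x => x - L x); last first.
  move=> x; rewrite (linopB lL).
  have h2 : L x + L x = E x + L (L x).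
    rewrite {1 2}fixL -scalerDl -rmorphD.
    by have -> : 2^-1 + 2^-1 = 1 :> R by [field]; rewrite scale1r.
  have -> : x - L x - (L x - L (L x)) = x - (L x + L x) + L (L x).
    by rewrite opprB opprD !addrA addrAC.
  by rewrite h2 /E opprD opprB addrA subrK addrC subrK.
split; first split=> //.
  by exists 2 => x; have := hnormB hip x (L x); have := L1 x; lra.
move=> x; rewrite lecE; apply/andP; split.
  apply/eqP; apply: (rsymmetric_Im _ lS).
  by move=> u v; rewrite !(ripE hip) sL.
rewrite -[leRHS]/(rip _ _) !(ripE hip) -hnorm_sqr // subr_ge0.
by have := rip_le_norm hip (L x) x; have := L1 x; have := hnorm_ge0 (ip := ip) x; nra.
Qed.

End PositiveOperators.

(** * The absolute value and lower bounds for positive operators *)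

Section AbsoluteValue.
Context {R : realType} {H : lmodType R[i]} {ip : H -> H -> R[i]}.
Hypothesis hip : is_inner_product ip.
Hypothesis hcpl : hcomplete ip.
Local Notation nrm := (hnorm ip).
Local Notation linop := (@is_linear_op R H).
Local Notation rip := (@rip R H ip).
Local Notation rsymmetric := (@rsymmetric R H ip).

Lemma rip_adjl f x y : bounded_op ip f -> rip (adj ip f x) y = rip x (f y).
Proof. by move=> bf; rewrite ripC // -rip_adj // ripC. Qed.

Lemma adj_comp_linear f : bounded_op ip f -> linop (adj ip f \o f).
Proof.
by move=> bf; apply: linop_comp; [exact: adj_linear|case: bf].
Qed.

Lemma adj_comp_sym f : bounded_op ip f -> rsymmetric (adj ip f \o f).
Proof. by move=> bf x y; rewrite /= rip_adjl // rip_adj. Qed.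

(** Existence of a positive root is enough for the epsilon term. The operator [adj ip T \o T] is
    divided by [M ^+ 2] to lie below the identity, and the root is multiplied back by [M]. *)
Lemma absopP T : bounded_op ip T ->
  positive_op ip (absop ip T) /\ forall x, absop ip T (absop ip T x) = adj ip T (T x).
Proof.
move=> bT; rewrite /absop.
set p := (X in epsilon _ X); apply: (epsilon_spec (inhabits id) p); rewrite /p {p}.
have [M M0 hM] := bounded_pos bT.
have lQ := adj_comp_linear bT; have sQ := adj_comp_sym bT.
have rQ x : rip ((adj ip T \o T) x) x = nrm (T x) ^+ 2 by rewrite /= rip_adjl // hnorm_sqr.
pose A x := (M ^- 2) *:: (adj ip T \o T) x.
have [| |x|S [[lS [c hc]] S0] SS] := @contraction_sqrt_exists _ _ _ hip hcpl A.
- by move=> a x y; rewrite /A lQ scalerDr !scalerA mulrC.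
- by move=> x y; rewrite /A !(ripE hip) sQ.
- have M2 : 0 < M ^+ 2 by rewrite exprn_gt0.
  rewrite /A !(ripE hip) rQ mulr_ge0 ?sqr_ge0 ?invr_ge0 ?(ltW M2) //=.
  rewrite mulrC ler_pdivrMr // mulrC -hnorm_sqr // -exprMn.
  by rewrite ler_pXn2r ?nnegrE ?hM // ?mulr_ge0 ?hnorm_ge0 // ltW.
exists (fun x => M *:: S x); split; last first.
  move=> x; rewrite (linopZ lS) SS /A !scalerA -!rmorphM.
  have -> : M * M * M ^- 2 = 1 by field; rewrite gt_eqF.
  by rewrite scale1r.
split; first split.
- by move=> a x y; rewrite lS scalerDr !scalerA mulrC.
- exists (M * c) => x; rewrite hnormZ // gtr0_norm // -mulrA ler_wpM2l ?hc //.
  exact: ltW.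
move=> x; case: (hip) => _ hZ _ _ _; rewrite hZ mulr_ge0 //.
by rewrite ler0c ltW.
Qed.

Lemma absop_norm T x : bounded_op ip T -> nrm (absop ip T x) = nrm (T x).
Proof.
move=> bT; have [pA hA] := absopP bT; rewrite /hnorm -!/(rip _ _).
by rewrite -(positive_op_sym hip pA) hA rip_adjl.
Qed.

(* With [m] the infimum of the form on unit vectors of [K], Cauchy-Schwarz for
   [A - m] turns almost-minimisers of the form into approximate eigenvectors. *)
Lemma positive_lower_bound (K : set H) A (g : R) : positive_op ip A ->
  (forall a x y, K x -> K y -> K (a *:: x - y)) ->
  (forall x, K x -> K (A x)) ->
  (forall x, K x -> g * nrm x <= nrm (A x)) ->
  forall x, K x -> g * rip x x <= rip (A x) x.
Proof.
move=> pA KB KA hg x Kx; have sA := positive_op_sym hip pA.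
have [[lA _] A0] := pA; have [M M0 hM] := bounded_pos (proj1 pA).
have KZ a z : K z -> K (a *:: z).
  (* The subtracted vector is 0, so closure under [a *:: x - y] also gives closure under real
     multiples. *)
  move=> Kz; have -> : a *:: z = a *:: z - (1 *:: z - z) by rewrite scale1r subrr subr0.
  by apply: (KB) => //; apply: KB.
have {}A0 z : 0 <= rip (A z) z by have := A0 z; rewrite lecE => /andP[].
have [->|/eqP x0] := eqVneq x 0; first by rewrite !(ripE hip) mulr0.
pose F : set R := [set rip (A z) z | z in K `&` [set z | nrm z = 1]].
have iF : has_inf F.
  split; last by exists 0 => _ [z _ <-].
  by eexists; exists ((nrm x)^-1 *:: x) => //=; split; [exact: KZ|exact: hnormalize].
pose m : R := inf F.
have m0 : 0 <= m by apply: lb_le_inf; [case: iF|move=> _ [z _ <-]].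
have mK z : K z -> m * rip z z <= rip (A z) z.
  move=> Kz; have [->|/eqP z0] := eqVneq z 0; first by rewrite !(ripE hip) mulr0.
  have zp := hnorm_gt0 hip z0.
  have : m <= rip (A ((nrm z)^-1 *:: z)) ((nrm z)^-1 *:: z).
    apply: ge_inf; first by case: iF.
    by exists ((nrm z)^-1 *:: z) => //; split; [exact: KZ|exact: hnormalize].
  rewrite (linopZ lA) !(ripE hip) mulrA -expr2 exprVn mulrC -hnorm_sqr //.
  by rewrite ler_pdivlMr // exprn_gt0.
apply: le_trans (mK _ Kx); apply: ler_wpM2r; first exact: rip_ge0.
rewrite leNgt; apply/negP => mg.
(* For a unit near-minimiser [y], [hg] forces [nrm (B y) >= g - m], whereas [posform_bound] makes
   [nrm (B y) ^+ 2] at most [M * d]. *)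
suff : (g - m) ^+ 2 <= 0 by rewrite leNgt exprn_gt0 // subr_gt0.
apply: (@le0_eps _ _ M); first exact: ltW.
move=> d d0; have [_ [y [Ky y1] <-] hy] := inf_adherent d0 iF.
pose B z := A z - m *:: z.
have lB : linop B.
  by apply: linop_sub => // a u v; rewrite scalerDr !scalerA mulrC.
have sB : rsymmetric B by move=> u v; rewrite /B !(ripE hip) sA.
have hB z : K z -> 0 <= rip (B z) z <= M * rip z z.
  move=> Kz; have := mK _ Kz; rewrite /B !(ripE hip) => h; apply/andP; split; first lra.
  have h1 := rip_le_norm hip (A z) z; have h2 := hM z.
  have h3 : nrm (A z) * nrm z <= M * nrm z * nrm z by rewrite ler_wpM2r ?hnorm_ge0.
  have := hnorm_sqr hip z; have := mulr_ge0 m0 (rip_ge0 hip z); nra.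
have KB' z : K z -> K (B z).
  move=> Kz; rewrite /B -[A z]scale1r; have := KB 1 (A z) (m *:: z) (KA _ Kz) (KZ m _ Kz).
  by [].
have := posform_bound hip lB sB M0 KB KB' hB Ky.
have h1 : g <= nrm (B y) + m.
  have := hg _ Ky; rewrite y1 mulr1 => h; apply: le_trans h _.
  have -> : A y = B y + m *:: y by rewrite /B subrK.
  by apply: le_trans (hnormD hip _ _) _; rewrite hnormZ // y1 mulr1 ger0_norm.
have : rip (B y) y <= d.
  by rewrite /B !(ripE hip) -(hnorm_sqr hip y) y1 expr1n mulr1; move: hy; rewrite -/m; lra.
rewrite -(hnorm_sqr hip (B y)) => h2 h3.
have h4 : M * rip (B y) y <= M * d by rewrite ler_pM2l.
apply: le_trans (le_trans h3 h4).
by rewrite ler_pXn2r ?nnegrE ?hnorm_ge0 // ?subr_ge0 ?(ltW mg) // lerBlDr.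
Qed.

(** The kernel is stable under ['i], so real orthogonality to all of it is already complex
    orthogonality. *)
Lemma orth_kerP f x : linop f ->
  orth_compl ip (ker f) x <-> forall y, f y = 0 -> rip y x = 0.
Proof.
move=> lf; split=> h y fy; first by have /(ip_eq0 hip)[] := h y fy.
by apply/(ip_eq0 hip); split; apply: h => //; rewrite (linopZ lf) fy scaler0.
Qed.

Lemma orth_kerB f a x y : linop f -> orth_compl ip (ker f) x ->
  orth_compl ip (ker f) y -> orth_compl ip (ker f) (a *:: x - y).
Proof.
move=> lf /(orth_kerP _ lf) hx /(orth_kerP _ lf) hy; apply/(orth_kerP _ lf) => z fz.
by rewrite !(ripE hip) hx // hy // mulr0 subr0.
Qed.

(** * The reduced minimum modulus *)

Section ReducedMinimumModulus.
Context {T : H -> H}.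
Hypothesis bT : bounded_op ip T.
Local Notation K := (orth_compl ip (ker T)).

Let gset := [set nrm (T x) | x in K `&` [set x | nrm x = 1]].

Let lbg : has_lbound gset.
Proof. by exists 0 => _ [x _ <-]; exact: hnorm_ge0. Qed.

Lemma gamma_ge0 : 0 <= gamma ip T.
Proof.
have [g0|g0] := pselect (gset !=set0).
  by apply: lb_le_inf => // _ [x _ <-]; exact: hnorm_ge0.
(* Without unit vectors orthogonal to the kernel, [gamma] is the default value 0 of the infimum of
   the empty set. *)
by rewrite /gamma -/gset (_ : gset = set0) ?inf0 //; apply/eqP/negPn/negP => /set0P.
Qed.

Lemma gamma_le x : K x -> gamma ip T * nrm x <= nrm (T x).
Proof.
move=> Kx; have lT := proj1 bT.
have [->|/eqP x0] := eqVneq x 0; first by rewrite hnorm0 // mulr0 hnorm_ge0.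
rewrite -ler_pdivlMr ?hnorm_gt0 //.
have -> : nrm (T x) / nrm x = nrm (T ((nrm x)^-1 *:: x)).
  by rewrite (linopZ lT) hnormZ // ger0_norm ?invr_ge0 ?hnorm_ge0 // mulrC.
apply: ge_inf => //; exists ((nrm x)^-1 *:: x) => //; split; last exact: hnormalize.
have -> : (nrm x)^-1 *:: x = ((nrm x)^-1 + 1) *:: x - x.
  by rewrite rmorphD scalerDl scale1r addrK.
exact: orth_kerB.
Qed.

Lemma gamma_approx x (e : R) : K x -> x <> 0 -> 0 < e ->
  exists y, [/\ K y, nrm y = 1 & nrm (T y) < gamma ip T + e].
Proof.
move=> Kx x0 e0; have ig : has_inf gset.
  split=> //; exists (nrm (T ((nrm x)^-1 *:: x))), ((nrm x)^-1 *:: x) => //.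
  split; last exact: hnormalize.
  have -> : (nrm x)^-1 *:: x = ((nrm x)^-1 + 1) *:: x - x.
    by rewrite rmorphD scalerDl scale1r addrK.
  by apply: orth_kerB => //; case: bT.
by have [_ [y [Ky y1] <-] hy] := inf_adherent e0 ig; exists y.
Qed.

End ReducedMinimumModulus.

(** * Partial isometries and their initial projections *)

Section PartialIsometry.
Context {X : H -> H}.
Hypothesis pX : partial_isometry ip X.
Let bX := proj1 pX.
Let lX := proj1 bX.

(** Orthogonal projection onto the initial space; [pisom_norm] reduces norms of [X x] to norms of
    [init_proj x]. *)
Definition init_proj : H -> H := adj ip X \o X.
Local Notation Q := init_proj.

Lemma init_proj_linear : linop Q. Proof. exact: adj_comp_linear. Qed.

Lemma init_proj_sym : rsymmetric Q. Proof. exact: adj_comp_sym. Qed.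

Lemma pisom_proj x : X (Q x) = X x. Proof. exact: (proj2 pX). Qed.

Lemma init_projK x : Q (Q x) = Q x.
Proof. by rewrite {1}/init_proj /= pisom_proj. Qed.

Lemma pisom_norm x : nrm (X x) = nrm (Q x).
Proof.
rewrite /hnorm -!/(rip _ _) -init_proj_sym init_projK.
by rewrite /init_proj /= rip_adjl.
Qed.

Lemma init_proj_le x : nrm (Q x) <= nrm x.
Proof.
have [->|/eqP q0] := eqVneq (Q x) 0; first by rewrite hnorm0 // hnorm_ge0.
rewrite -(ler_pM2l (hnorm_gt0 hip q0)) -expr2 hnorm_sqr // init_proj_sym init_projK.
by rewrite -init_proj_sym rip_le_norm.
Qed.

Lemma pisom_le x : nrm (X x) <= nrm x.
Proof. by rewrite pisom_norm init_proj_le. Qed.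

Lemma init_proj_eq0 x : Q x = 0 <-> X x = 0.
Proof.
split=> h; first by apply: (hnorm_eq0 hip); rewrite pisom_norm h hnorm0.
by rewrite /init_proj /= h; apply: linop0; exact: adj_linear.
Qed.

Lemma range_init_proj x : range Q x <-> Q x = x.
Proof. by split=> [[y _ <-]|<-]; [exact: init_projK|exists x]. Qed.

(** For [x] orthogonal to the kernel, [x - Q x] lies in the kernel and is orthogonal to both [x] and
    [Q x], hence to itself. *)
Lemma orth_ker_init_proj x : orth_compl ip (ker X) x <-> Q x = x.
Proof.
split=> [/(orth_kerP _ lX) h|h].
  have Xk : X (x - Q x) = 0 by rewrite (linopB lX) pisom_proj subrr.
  apply/eqP; rewrite eq_sym -subr_eq0; apply/eqP/(rip_eq0 hip).
  rewrite ripDr // ripNr // h // -init_proj_sym.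
  by have /init_proj_eq0 -> := Xk; rewrite rip0l // subrr.
apply/(orth_kerP _ lX) => y /init_proj_eq0 Xy.
by rewrite -h -init_proj_sym Xy rip0l.
Qed.

End PartialIsometry.
End AbsoluteValue.

(** * Dimensions and the index of two projections *)

Section Index.
Context {R : realType} {H : lmodType R[i]} {ip : H -> H -> R[i]}.
Hypothesis hip : is_inner_product ip.

Lemma hdim_trivial (S : set H) : (forall x, S x -> x = 0) -> hdim ip S = 0%E.
Proof.
move=> S0; rewrite /hdim (_ : [set n : nat | _] = [set 0%N]).
  by rewrite image_set1 ereal_sup1.
apply/seteqP; split=> [n [u [Su ou]]|_ ->] /=; last first.
  by exists (fun=> 0); split; case.
case: n u Su ou => // n u Su ou; have := ou ord0 ord0.
by rewrite (S0 _ (Su _)) ip_self // rip0l // eqxx => /eqP; rewrite eq_sym oner_eq0.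
Qed.

Lemma hdim_ge1 (S : set H) x : S x -> hnorm ip x = 1 -> (1 <= hdim ip S)%E.
Proof.
move=> Sx x1; apply: ereal_sup_ubound; exists 1%N => //.
exists (fun=> x); split=> // i j; rewrite !ord1 eqxx ip_self // -hnorm_sqr // x1.
by rewrite expr1n.
Qed.

(** Makes the polar factor an admissible competitor: the two dimensions agree, so either they cancel
    or the default 0 applies. *)
Lemma jind_refl (P : H -> H) : (jind ip P P <= 0)%E.
Proof.
rewrite /jind (setIC (ker P)); case: ifP => //; rewrite orbb => h.
by rewrite subee.
Qed.

(** When the subtracted dimension is 0, the index equals the first dimension; a nonzero vector there
    could be normalised and would make it at least 1. *)
Lemma jind_le0_trivial (P Q : H -> H) :
  (forall a x, (range P `&` ker Q) x -> (range P `&` ker Q) (a *: x)) ->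
  (jind ip P Q <= 0)%E ->
  (forall x, (ker P `&` range Q) x -> x = 0) ->
  forall x, (range P `&` ker Q) x -> x = 0.
Proof.
move=> hZ; rewrite /jind => hj h0; move: hj; rewrite (hdim_trivial h0) /= orbT sube0 => hj.
move=> x Sx; apply: contrapT => x0.
have := le_trans (hdim_ge1 (hZ _ _ Sx) (hnormalize hip x0)) hj.
by rewrite lee_fin ler10.
Qed.

End Index.

(** * Distance to the polar factor, and near-minimisers in an initial space *)

Section Approximation.
Context {R : realType} {H : lmodType R[i]} {ip : H -> H -> R[i]}.
Hypothesis hip : is_inner_product ip.
Hypothesis hcpl : hcomplete ip.
Local Notation nrm := (hnorm ip).
Local Notation rip := (@rip R H ip).
Context {T V : H -> H}.
Hypothesis bT : bounded_op ip T.
Hypothesis T0 : T <> (fun _ => 0).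
Hypothesis pV : polar_factor ip T V.

Let lT := proj1 bT.
Let piV : partial_isometry ip V. Proof. by case: pV. Qed.
Let bV := proj1 piV.
Let lV := proj1 bV.
Let kVT x : V x = 0 <-> T x = 0.
Proof.
have [_ _ h] := pV.
by split=> hx; [have : ker V x by []; rewrite h|have : ker T x by []; rewrite -h].
Qed.

Local Notation P := (adj ip V \o V).
Local Notation K := (orth_compl ip (ker T)).

Let KP x : K x <-> P x = x.
Proof. by case: (pV) => _ _ <-; exact: orth_ker_init_proj. Qed.

Let TP x : T (P x) = T x.
Proof.
apply/eqP; rewrite -subr_eq0 -(linopB lT); apply/eqP/kVT.
by rewrite (linopB lV) (pisom_proj piV) subrr.
Qed.

Let M := opnorm ip T.

Lemma opnorm_gt0 : 0 < M.
Proof.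
rewrite lt_def opnorm_ge0 // andbT; apply/eqP => M0; apply: T0.
apply/funext => x; apply: (hnorm_eq0 hip); apply/eqP.
rewrite eq_le hnorm_ge0 andbT; have := le_opnorm hip bT x.
by rewrite -/M M0 mul0r.
Qed.

(** On [K] the form of [absop ip T] minus the identity lies between [- d] and [d]; [posform_bound],
    applied after a shift that makes the form nonnegative, converts this into a norm bound. *)
Lemma polar_dist_le (d : R) : M - 1 <= d -> 1 - gamma ip T <= d ->
  opnorm ip (fun x => T x - V x) <= d.
Proof.
(* As [T] is nonzero, [K] contains a nonzero vector, so [gamma ip T <= M]; adding [d1] and [d2]
   gives [0 <= 2 * d]. *)
move=> d1 d2; have d0 : 0 <= d.
  have [x] : exists x, T x <> 0.
    apply: contrapT => h; apply: T0; apply/funext => x.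
    by apply: contrapT => Tx; apply: h; exists x.
  rewrite -TP => /eqP Tx.
  have Px0 : P x <> 0 by move=> h; move: Tx; rewrite h (linop0 lT) eqxx.
  have Kx : K (P x) by apply/KP; exact: init_projK.
  have := le_trans (gamma_le hip bT Kx) (le_opnorm hip bT (P x)).
  rewrite ler_pM2r ?hnorm_gt0 // -/M; lra.
have [pA hA] := absopP hip hcpl bT; set A := absop ip T in pA hA.
have nA x : nrm (A x) = nrm (T x) by exact: absop_norm.
have sA := positive_op_sym hip pA; have lA := proj1 (proj1 pA).
have KA x : K (A x).
  apply/(orth_kerP hip _ lT) => y Ty; rewrite -sA.
  have -> : A y = 0 by apply: (hnorm_eq0 hip); rewrite nA Ty hnorm0.
  exact: rip0l.
apply: opnorm_le => // x; rewrite -subr_le0.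
apply: (@le0_eps _ _ (nrm x)) => [|e e0]; first exact: hnorm_ge0.
(* The slack [e] keeps [2 * d'] positive, as [posform_bound] demands, even when [d = 0]. *)
rewrite lerBlDr -[_ * e]mulrC -mulrDl; set d' := e + d.
set p := P x; have Kp : K p by apply/KP; exact: init_projK.
have d'0 : 0 < d' by rewrite /d' ltr_wpDr.
have -> : T x - V x = V (A p - p).
  have [_ hTV _] := pV.
  by rewrite (linopB lV) -hTV /p TP (pisom_proj piV).
apply: le_trans (pisom_le hip hcpl piV _) _.
suff : nrm (A p - p) <= d' * nrm p.
  move=> h; apply: le_trans h _; rewrite ler_pM2l //.
  exact: init_proj_le.
pose B z := A z - (1 - d') *:: z.
have lB : @is_linear_op R H B.
  by apply: linop_sub => // a u v; rewrite scalerDr !scalerA mulrC.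
have sB : rsymmetric (ip := ip) B by move=> u v; rewrite /B !(ripE hip) sA.
have KB a u v : K u -> K v -> K (a *:: u - v) by exact: orth_kerB.
have KBz z : K z -> K (B z).
  move=> Kz; have -> : B z = (-1) *:: ((1 - d') *:: z - A z).
    by rewrite rmorphN1 scaleN1r opprB.
  have Kw := KB (1 - d') z (A z) Kz (KA z).
  set w := _ - _ in Kw *; have -> : (-1) *:: w = 0 *:: w - w.
    by rewrite rmorphN1 scaleN1r scale0r sub0r.
  exact: KB.
have hB z : K z -> 0 <= rip (B z) z <= 2 * d' * rip z z.
  move=> Kz; have h1 : gamma ip T * rip z z <= rip (A z) z.
    apply: (positive_lower_bound hip pA KB _ _ Kz) => [u _|u Ku]; first exact: KA.
    by rewrite nA; exact: gamma_le.
  have h2 : rip (A z) z <= M * rip z z.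
    apply: le_trans (rip_le_norm hip _ _) _; rewrite nA -hnorm_sqr // mulrA.
    by rewrite ler_wpM2r ?hnorm_ge0 //; exact: le_opnorm.
  have z0 := rip_ge0 hip z.
  have h3 : (1 - d') * rip z z <= gamma ip T * rip z z.
    by rewrite ler_wpM2r // /d'; lra.
  have h4 : M * rip z z <= (1 + d') * rip z z.
    by rewrite ler_wpM2r // /d'; lra.
  rewrite /B !(ripE hip); apply/andP; split; lra.
have d2' : 0 < 2 * d' by rewrite mulr_gt0.
have := posform_bound hip lB sB d2' KB KBz hB Kp.
move=> h; rewrite -(@ler_pXn2r _ 2) ?nnegrE ?mulr_ge0 ?hnorm_ge0 ?(ltW d'0) //.
rewrite exprMn !hnorm_sqr //.
(* In the expanded square, the bound on [rip (B p) (B p)] is absorbed by the cross term, leaving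
   [d' ^+ 2 * rip p p]. *)
have -> : A p - p = B p - d' *:: p.
  by rewrite /B -addrA -opprD -scalerDl -rmorphD subrK scale1r.
move: (B p) h => b h; rewrite !(ripE hip) (ripC hip p b); lra.
Qed.

(* If no unit vector of [ran Q] lies in [ker T], then [ran P] meets [ker Q]
   trivially, so [P (ran Q)] is dense in [ran P] and almost-minimisers of [|T x|]
   on [ran P] can be taken of the form [P y] with [y] in [ran Q]; moreover
   [T P y = T y] and [|P y| <= |y|]. *)
Lemma near_min_in_range X (e : R) : partial_isometry ip X ->
  (jind ip P (adj ip X \o X) <= 0)%E -> 0 < e ->
  exists y, [/\ nrm y = 1, nrm (X y) = 1 & nrm (T y) <= gamma ip T + e].
Proof.
move=> pX hj e0; have g0 := @gamma_ge0 _ _ ip T.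
set Q := adj ip X \o X in hj.
have lQ : @is_linear_op R H Q by exact: init_proj_linear.
have nX x : nrm (X x) = nrm (Q x) by exact: pisom_norm.
have unit_ y : Q y = y -> y <> 0 -> nrm (T y) <= (gamma ip T + e) * nrm y ->
    exists y, [/\ nrm y = 1, nrm (X y) = 1 & nrm (T y) <= gamma ip T + e].
  move=> Qy y0 hy; exists ((nrm y)^-1 *:: y); rewrite nX (linopZ lQ) Qy hnormalize //.
  split=> //; rewrite (linopZ lT) hnormZ // ger0_norm ?invr_ge0 ?hnorm_ge0 //.
  by rewrite mulrC ler_pdivrMr // hnorm_gt0.
have [[y [[/= Py Qy] y0]]|hn] := pselect (exists y, (ker P `&` range Q) y /\ y <> 0).
  apply: (unit_ y) => //; first by apply/range_init_proj.
  rewrite (_ : T y = 0) ?hnorm0 ?mulr_ge0 ?hnorm_ge0 // ?addr_ge0 // ?ltW //.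
  by rewrite -TP /= [adj _ _ _]Py (linop0 lT).
have {hn}PQ : forall x, (range P `&` ker Q) x -> x = 0.
  apply: (jind_le0_trivial hip _ hj) => [a x [Px Qx]|x Sx]; last first.
    by apply: contrapT => x0; apply: hn; exists x.
  split; last by rewrite /ker /= (linopZ lQ) Qx scaler0.
  apply/range_init_proj => //; move/range_init_proj: Px => Px.
  by rewrite (linopZ (init_proj_linear hip hcpl piV)) Px.
have [x Tx0] : exists x, T x <> 0.
  apply: contrapT => h; apply: T0; apply/funext => x.
  by apply: contrapT => Tx; apply: h; exists x.
have Px0 : P x <> 0 by move=> h; move: Tx0; rewrite -TP h (linop0 lT).
have KPx : K (P x) by apply/KP; exact: init_projK.
have [xi [Kxi xi1 hxi]] := gamma_approx hip bT KPx Px0 (divr_gt0 e0 (ltr0Sn _ 1)).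
have lP : @is_linear_op R H P := init_proj_linear hip hcpl piV.
have sP : rsymmetric (ip := ip) P := init_proj_sym hip hcpl piV.
have sQ : rsymmetric (ip := ip) Q := init_proj_sym hip hcpl pX.
have QK u : Q (Q u) = Q u by exact: init_projK.
have PK u : P (P u) = P u by exact: init_projK.
(* [l] is the orthogonal projection of [xi] onto the closure of [P (ran Q)]. *)
have [|||||z|l [hl hort]] := @riesz_subspace _ _ _ hip hcpl (range (fun z => P (Q z)))
  (rip ^~ xi) (nrm xi).
- by exists 0 => //; cbv beta; rewrite (linop0 lQ) (linop0 lP).
- by move=> _ _ [u _ <-] [v _ <-]; exists (u + v) => //; cbv beta; rewrite (linopD lQ) (linopD lP).
- by move=> a _ [u _ <-]; exists (a *:: u) => //; cbv beta; rewrite (linopZ lQ) (linopZ lP).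
- by move=> u v; rewrite ripDl.
- by move=> a u; rewrite ripZl.
- by rewrite mulrC rip_le_norm.
(* [xi - l] is orthogonal to [P (ran Q)], which puts [P (xi - l)] in [ker Q] as well as in
   [ran P]. *)
have Pz0 : P (xi - l) = 0.
  apply: PQ; split; first by exists (xi - l).
  apply: (rip_eq0 hip); set q := Q _.
  rewrite {2}/q -sQ QK -/q -sP.
  by rewrite ripDr // ripNr // hort ?subrr //; exists (P (xi - l)).
have xiP : xi = P l.
  by apply/eqP; rewrite -subr_eq0 -{1}(iffLR (KP xi) Kxi) -(linopB lP) Pz0.
(* Replacing [xi] by [y] costs [M * d], and normalising [y] costs [(gamma ip T + e) * d]; together
   they are [d * D = e / 2]. *)
pose D := M + gamma ip T + e.
have M0 : 0 < M := opnorm_gt0.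
have g0' : 0 <= gamma ip T := g0.
have D0 : 0 < D by rewrite /D; lra.
pose d := e / 2 / D; have d0 : 0 < d by rewrite !divr_gt0.
have dD : d * D = e / 2 by rewrite /d divfK // gt_eqF.
have d1 : d < 1 by rewrite /d ltr_pdivrMr // mul1r /D; lra.
have [_ [u _ <-]] := hl _ d0; cbv beta; set y := Q u => hy.
have hPy : nrm (xi - P y) <= d.
  rewrite xiP -(PK y) -(linopB lP).
  by apply: le_trans (init_proj_le hip hcpl piV _) _; rewrite hdistC // ltW.
have y1 : 1 - d <= nrm y.
  apply: le_trans (init_proj_le hip hcpl piV y).
  by have := hnorm_le_add hip xi (P y); rewrite xi1; move: hPy; lra.
apply: (unit_ y); first exact: init_projK.
  by move=> y0; move: y1; rewrite y0 hnorm0 //; lra.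
have h1 : nrm (T y) <= nrm (T xi) + M * d.
  rewrite -(TP y); have := hnorm_le_add hip (T (P y)) (T xi).
  rewrite -(linopB lT); have := le_opnorm hip bT (P y - xi).
  rewrite (hdistC hip (P y)) -/M => h2 h3.
  have : M * nrm (xi - P y) <= M * d by rewrite ler_pM2l.
  lra.
have h2 : (gamma ip T + e) * (1 - d) <= (gamma ip T + e) * nrm y.
  by rewrite ler_wpM2l // addr_ge0 // ltW.
move: dD; rewrite /D; lra.
Qed.
End Approximation.

(** * Passing between epsilon statements and sequences *)

Section Sequences.
Context {R : realType}.

Lemma cvg_eps (u : nat -> R) (l e : R) : u @ \oo --> l -> 0 < e ->
  exists N, forall n, (N <= n)%N -> `|l - u n| < e.
Proof. by move=> /cvgrPdist_lt h e0; have [N _ hN] := h _ e0; exists N. Qed.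

Lemma cvg_natSinv (u : nat -> R) (l : R) :
  (forall n, `|u n - l| <= n.+1%:R^-1) -> u @ \oo --> l.
Proof.
move=> h; apply/cvgrPdist_lt => e e0; have [N hN] := natSinv_lt e0.
by exists N => // n /hN; rewrite /= distrC; apply: le_lt_trans.
Qed.

Lemma seq_of_eps (T : Type) (P : R -> T -> Prop) :
  (forall e, 0 < e -> exists x, P e x) -> exists x, forall n, P n.+1%:R^-1 (x n).
Proof.
move=> h; have [n|x hx] := @boolp.choice nat T (fun n => P n.+1%:R^-1).
  by apply: h; rewrite invr_gt0.
by exists x.
Qed.
End Sequences.

(** * Lower bounds for the distance and extremal sequences *)

Section DistanceFormula.
Context {R : realType} {H : lmodType R[i]} {ip : H -> H -> R[i]}.
Hypothesis hip : is_inner_product ip.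
Hypothesis hcpl : hcomplete ip.
Local Notation nrm := (hnorm ip).
Context {T V : H -> H}.
Hypothesis bT : bounded_op ip T.
Hypothesis T0 : T <> (fun _ => 0).
Hypothesis pV : polar_factor ip T V.
Local Notation M := (opnorm ip T).
Local Notation dist X := (opnorm ip (fun x => T x - X x)).

Section LowerBounds.
Context {X : H -> H}.
Hypothesis pX : partial_isometry ip X.
Let bTX : bounded_op ip (fun x => T x - X x).
Proof. by apply: bounded_sub => //; case: pX. Qed.
Hypothesis hj : (jind ip (adj ip V \o V) (adj ip X \o X) <= 0)%E.

Lemma dist_ge_opnorm : M - 1 <= dist X.
Proof.
rewrite lerBlDr; apply: opnorm_le => //; first by rewrite addr_ge0 // opnorm_ge0.
move=> x; apply: le_trans (hnorm_le_add hip (T x) (X x)) _.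
rewrite mulrDl mul1r addrC lerD ?pisom_le //.
exact: (le_opnorm hip bTX).
Qed.

Lemma dist_ge_gamma : 1 - gamma ip T <= dist X.
Proof.
rewrite -subr_le0; apply: (@le0_eps _ _ 1) => // e e0; rewrite mul1r.
have [y [y1 Xy1 Ty]] := near_min_in_range hip hcpl bT T0 pV pX hj e0.
have := hnorm_le_add hip (X y) (T y); rewrite Xy1 (hdistC hip (X y)).
have := le_opnorm hip bTX y; rewrite y1; lra.
Qed.

(** Unit vectors with [nrm (T x)] near [M >= 1 + D] make [T x = X x + (T x - X x)] nearly extremal,
    the summands having norms at most 1 and [D]. This yields condition (i). *)
Lemma maximal_sequence : dist X <= M - 1 ->
  exists xi : nat -> H, [/\ (forall n, nrm (xi n) = 1),
    (fun n => nrm (X (xi n))) @ \oo --> (1 : R) &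
    (fun n => nrm ((dist X)%:C%C *: X (xi n) - (T (xi n) - X (xi n)))) @ \oo --> (0 : R)].
Proof.
set D := dist X => DM.
have D0 : 0 <= D by exact: opnorm_ge0.
have M0 : 0 < M by exact: opnorm_gt0.
have [|xi hxi] := @seq_of_eps R H (fun e x => [/\ nrm x = 1, `|nrm (X x) - 1| <= e &
    nrm (D *:: X x - (T x - X x)) <= e]); last first.
  exists xi; split=> [n||]; first by case: (hxi n).
    by apply: cvg_natSinv => n; case: (hxi n).
  apply: cvg_natSinv => n; rewrite subr0 ger0_norm ?hnorm_ge0 //.
  by case: (hxi n).
(* The squared error is at most [2 * D * (1 + D) * d]. In the minimum below, 1 keeps [1 + D - d]
   nonnegative for squaring and [e] controls [nrm (X x)]. *)
move=> e e0; pose C := 2 * D * (1 + D) + 1.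
have C0 : 0 < C by rewrite ltr_wpDl // !mulr_ge0 // addr_ge0.
pose d := Num.min 1 (Num.min e (e ^+ 2 / C)).
have d0 : 0 < d by rewrite !lt_min ltr01 e0 divr_gt0 // exprn_gt0.
have d1 : d <= 1 by rewrite /d ge_min lexx.
have de : d <= e by rewrite /d !ge_min lexx orbT.
have dC : C * d <= e ^+ 2 by rewrite mulrC -ler_pdivlMr // /d !ge_min lexx !orbT.
have [x x1 hx] := opnorm_approx hip bT d0 M0.
have hX : nrm (X x) <= 1 by rewrite -x1; exact: pisom_le.
have hTX : nrm (T x - X x) <= D.
  by have := le_opnorm hip bTX x; rewrite x1 mulr1.
have hsum := hnorm_le_add hip (T x) (X x).
exists x; split=> //.
  by rewrite ler_norml; apply/andP; split; lra.
rewrite -(@ler_pXn2r _ 2) ?nnegrE ?hnorm_ge0 ?(ltW e0) //.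
have := hnorm_comb_sqr hip 1 D (X x) (T x - X x).
rewrite scale1r !mul1r (addrC (X x)) subrK => ->.
set a := nrm (X x) in hX *; set b := nrm (T x - X x) in hTX *.
have a0 : 0 <= a by exact: hnorm_ge0.
have b0 : 0 <= b by exact: hnorm_ge0.
have a2 : a ^+ 2 <= 1 by rewrite expr_le1.
have b2 : b ^+ 2 <= D ^+ 2 by rewrite ler_pXn2r.
have t2 : (1 + D - d) ^+ 2 <= nrm (T x) ^+ 2.
  by rewrite ler_pXn2r ?nnegrE ?hnorm_ge0 //; lra.
have h1 : D * (1 + D - d) ^+ 2 <= D * nrm (T x) ^+ 2 by rewrite ler_wpM2l.
have h2 : (1 + D) * (D * a ^+ 2 + b ^+ 2) <= (1 + D) * (D + D ^+ 2).
  rewrite ler_wpM2l ?addr_ge0 // lerD //.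
  by rewrite -[leRHS]mulr1 ler_wpM2l.
have h3 : 0 <= D * d ^+ 2 by rewrite mulr_ge0 // sqr_ge0.
move: dC; rewrite /C; lra.
Qed.

(** Here [X y = (X y - T y) + T y] is nearly extremal: its norm is 1, while the summands have norms
    at most [D = 1 - g] and nearly [g]. This yields condition (ii). *)
Lemma minimal_sequence : dist X <= 1 - gamma ip T ->
  exists xi : nat -> H, [/\ (forall n, nrm (xi n) = 1),
    (fun n => nrm (X (xi n))) @ \oo --> (1 : R),
    (fun n => nrm ((dist X)%:C%C *: X (xi n) + (T (xi n) - X (xi n)))) @ \oo --> (0 : R) &
    (fun n => nrm ((gamma ip T)%:C%C *: X (xi n) - T (xi n))) @ \oo --> (0 : R)].
Proof.
move=> hD; have eD : dist X = 1 - gamma ip T.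
  by apply/eqP; rewrite eq_le hD dist_ge_gamma.
set D := dist X in hD eD *; set g := gamma ip T in hD eD *.
have D0 : 0 <= D by exact: opnorm_ge0.
have g0 : 0 <= g by exact: gamma_ge0.
have [|xi hxi] := @seq_of_eps R H (fun e x => [/\ nrm x = 1, nrm (X x) = 1 &
    nrm (g *:: X x - T x) <= e]); last first.
  have lim0 : (fun n => nrm (g *:: X (xi n) - T (xi n))) @ \oo --> (0 : R).
    apply: cvg_natSinv => n; rewrite subr0 ger0_norm ?hnorm_ge0 //.
    by case: (hxi n).
  exists xi; split=> [n||//|//]; first by case: (hxi n).
    by apply: cvg_natSinv => n; case: (hxi n) => _ -> _; rewrite subrr normr0.
  (* Because [D = 1 - g], the two residual vectors of (ii) differ only by a sign. *)
  suff -> : (fun n => nrm (D *:: X (xi n) + (T (xi n) - X (xi n)))) =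
      (fun n => nrm (g *:: X (xi n) - T (xi n))) by [].
  apply/funext => n; rewrite -(hnormN hip (g *:: _ - _)) opprB eD.
  congr (nrm _); rewrite rmorphB scalerBl scale1r addrC addrA subrK.
  by [].
(* With [D + g = 1] the squared error is at most [2 * D * g * d + D * d ^+ 2], and [d <= 1] bounds
   the last term by [D * d]. *)
move=> e e0; pose C := D * (2 * g + 1) + 1.
have C0 : 0 < C by rewrite ltr_wpDl // mulr_ge0 // addr_ge0 // mulr_ge0.
pose d := Num.min 1 (e ^+ 2 / C).
have d0 : 0 < d by rewrite lt_min ltr01 divr_gt0 // exprn_gt0.
have d1 : d <= 1 by rewrite /d ge_min lexx.
have dC : C * d <= e ^+ 2 by rewrite mulrC -ler_pdivlMr // /d ge_min lexx orbT.
have [y [y1 Xy1 Ty]] := near_min_in_range hip hcpl bT T0 pV pX hj d0.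
rewrite -/g in Ty.
exists y; split=> //.
rewrite -(@ler_pXn2r _ 2) ?nnegrE ?hnorm_ge0 ?(ltW e0) //.
have -> : g *:: X y - T y = g *:: (X y - T y) - D *:: T y.
  by rewrite eD rmorphB scalerBl scale1r scalerBr opprB addrA subrK.
rewrite (hnorm_comb_sqr hip) subrK Xy1 eD.
have hTX : nrm (X y - T y) <= D.
  by have := le_opnorm hip bTX y; rewrite y1 mulr1 hdistC.
set a := nrm (T y) in Ty *; set b := nrm (X y - T y) in hTX *.
have a2 : a ^+ 2 <= (g + d) ^+ 2.
  by rewrite ler_pXn2r ?nnegrE ?hnorm_ge0 // addr_ge0 // ltW.
have b2 : b ^+ 2 <= D ^+ 2 by rewrite ler_pXn2r ?nnegrE ?hnorm_ge0.
have h1 : D * a ^+ 2 <= D * (g + d) ^+ 2 by rewrite ler_wpM2l.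
have h2 : g * b ^+ 2 <= g * D ^+ 2 by rewrite ler_wpM2l.
have h3 : D * d ^+ 2 <= D * d by rewrite ler_wpM2l // expr2 -[leRHS]mulr1 ler_pM2l.
have eg : g = 1 - D by rewrite eD; ring.
rewrite -eD; have -> : D + g = 1 by rewrite eD; ring.
rewrite mul1r expr1n mulr1.
have h4 : g * D ^+ 2 + D * (g + d) ^+ 2 - D * g = D * (2 * g * d) + D * d ^+ 2.
  by rewrite eg; ring.
move: dC; rewrite /C; lra.
Qed.

End LowerBounds.
End DistanceFormula.


(** * Characterisation of the optimal partial isometries *)

Unset Implicit Arguments. Set Strict Implicit.

Theorem theorem3p2 (R : realType) (H : lmodType R[i]) (ip : H -> H -> R[i])
  (hH : is_hilbert ip)
  (T : H -> H) (hT : bounded_op ip T) (hT0 : T <> (fun _ => 0))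
  (Vp : H -> H) (hVp : polar_factor ip T Vp)
  (X0 : H -> H) (hX0 : partial_isometry ip X0)
  (hj0 : (jind ip (adj ip Vp \o Vp) (adj ip X0 \o X0) <= 0)%E) :
  (forall X : H -> H, partial_isometry ip X ->
     (jind ip (adj ip Vp \o Vp) (adj ip X \o X) <= 0)%E ->
     opnorm ip (fun x => T x - X0 x) <= opnorm ip (fun x => T x - X x))
  <->
  ((exists xi : nat -> H,
      [/\ (forall n, hnorm ip (xi n) = 1),
          (fun n => hnorm ip (X0 (xi n))) @ \oo --> (1 : R) &
          (fun n => hnorm ip ((opnorm ip (fun x => T x - X0 x))%:C%C *: X0 (xi n)
                               - (T (xi n) - X0 (xi n)))) @ \oo --> (0 : R)])
   \/
   (exists xi : nat -> H,
      [/\ (forall n, hnorm ip (xi n) = 1),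
          (fun n => hnorm ip (X0 (xi n))) @ \oo --> (1 : R),
          (fun n => hnorm ip ((opnorm ip (fun x => T x - X0 x))%:C%C *: X0 (xi n)
                               + (T (xi n) - X0 (xi n)))) @ \oo --> (0 : R) &
          (fun n => hnorm ip ((gamma ip T)%:C%C *: X0 (xi n) - T (xi n))) @ \oo --> (0 : R)])).
Proof.
have [hip hcpl _] := hH; have [pV _ _] := hVp.
have bTX : bounded_op ip (fun x => T x - X0 x) by apply: bounded_sub => //; case: hX0.
have D0 := opnorm_ge0 hip bTX.
set D := opnorm ip (fun x => T x - X0 x) in D0 *.
split=> [hmin|[[xi [xi1 hX h1]]|[xi [xi1 hX h1 h2]]] X pX hj].
(* Optimality is tested against the polar factor; the term attaining the maximum decides between (i)
   and (ii). *)
- have : D <= Num.max (opnorm ip T - 1) (1 - gamma ip T).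
    apply: le_trans (hmin Vp pV (jind_refl _)) _.
    by apply: (polar_dist_le hip hcpl hT hT0 hVp); rewrite le_max lexx ?orbT.
  rewrite le_max => /orP[]; [left|right].
    exact: (maximal_sequence hip hcpl hT hT0 hX0).
  exact: (minimal_sequence hip hcpl hT hT0 hVp).
(* Condition (i) says that [(1 + D) X0 x - T x] tends to 0 along the sequence, so
   [1 + D <= opnorm ip T] in the limit. *)
- apply: le_trans (dist_ge_opnorm hip hcpl hT pX).
  rewrite lerBrDr -subr_le0.
  apply: (@le0_eps _ _ (2 + D)) => [|e e0]; first by rewrite addr_ge0.
  have [N hN] := cvg_eps hX e0; have [N' hN'] := cvg_eps h1 e0.
  have {}hN := hN _ (leq_maxl N N'); have {}hN' := hN' _ (leq_maxr N N').
  set x := xi (maxn N N') in hN hN'.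
  have hT1 : hnorm ip (T x) <= opnorm ip T.
    by have := le_opnorm hip hT x; rewrite xi1 mulr1.
  move: hN'; rewrite sub0r normrN ger0_norm ?hnorm_ge0 // => hN'.
  have : (1 + D) * hnorm ip (X0 x) <= hnorm ip (T x) + e.
    have -> : (1 + D) * hnorm ip (X0 x) = hnorm ip ((1 + D)%:C%C *: X0 x).
      by rewrite hnormZ // ger0_norm // addr_ge0.
    apply: le_trans (hnorm_le_add hip _ (T x)) _; rewrite lerD2l.
    have -> : (1 + D)%:C%C *: X0 x - T x = D%:C%C *: X0 x - (T x - X0 x).
      by rewrite rmorphD scalerDl scale1r opprB addrA (addrC (X0 x)).
    exact: ltW.
  move: hN; rewrite ltr_norml => /andP[_ hN] h.
  have : (1 + D) * (1 - e) <= (1 + D) * hnorm ip (X0 x).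
    by rewrite ler_wpM2l ?addr_ge0 //; lra.
  lra.
(* The two residuals of (ii) add up to [(D + gamma ip T - 1) X0 x], which tends to 0 while [X0 x]
   has norm tending to 1. *)
- apply: le_trans (dist_ge_gamma hip hcpl hT hT0 hVp pX hj).
  rewrite lerBrDr -subr_le0.
  (* The goal is restored with its negation [gt0] at hand, so the scalar may be treated as positive
     in the estimates. *)
  rewrite leNgt; apply/negP => gt0; move: (gt0); apply/negP; rewrite -leNgt.
  apply: (@le0_eps _ _ (2 + (D + gamma ip T - 1))) => [|e e0]; first lra.
  have [N hN] := cvg_eps hX e0; have [N1 hN1] := cvg_eps h1 e0.
  have [N2 hN2] := cvg_eps h2 e0.
  pose n := maxn N (maxn N1 N2); set x := xi n.
  have {}hN := hN n (leq_maxl _ _).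
  have {}hN1 := hN1 n (leq_trans (leq_maxl _ _) (leq_maxr _ _)).
  have {}hN2 := hN2 n (leq_trans (leq_maxr _ _) (leq_maxr _ _)).
  rewrite -/x in hN hN1 hN2.
  move: hN1 hN2; rewrite !sub0r !normrN !ger0_norm ?hnorm_ge0 // => hN1 hN2.
  have : (D + gamma ip T - 1) * hnorm ip (X0 x) <= 2 * e.
    rewrite -{1}(ger0_norm (ltW gt0)) -hnormZ //.
    have -> : (D + gamma ip T - 1)%:C%C *: X0 x =
      (D%:C%C *: X0 x + (T x - X0 x)) + ((gamma ip T)%:C%C *: X0 x - T x).
      rewrite rmorphB rmorphD scalerBl scalerDl scale1r.
      by rewrite [RHS]addrACA (addrAC (T x)) subrr sub0r.
    by apply: le_trans (hnormD hip _ _) _; lra.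
  move: hN; rewrite ltr_norml => /andP[_ hN] h.
  have : (D + gamma ip T - 1) * (1 - e) <= (D + gamma ip T - 1) * hnorm ip (X0 x).
    by rewrite ler_wpM2l ?(ltW gt0) //; lra.
  lra.
Qed.
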